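(* Let $\Delta$ be an abstract simplicial complex of subsets of $[m]$ and let $\mathcal{P}$ be its pseudofactor poset. Then the following two subgroups of $S_{\mathcal{I}}$ coincide: the intersection over the facets $D$ of $\Delta$ of the wreath products $S_{\mathcal{I}_{D^C}}\,\mathrm{wr}\,S_{\mathcal{I}_D}$, and the wreath product of the symmetric groups $(S_{\mathcal{I}_\rho})_{\rho\in\mathcal{P}}$ indexed by the poset $\mathcal{P}$; that is, $$\bigcap_{D\in\mathrm{facet}(\Delta)}\bigl(S_{\mathcal{I}_{D^C}}\ \mathrm{wr}\ S_{\mathcal{I}_D}\bigr)=\prod_{\rho\in\mathcal{P}}(S_{\mathcal{I}_\rho})^{\mathcal{I}_{A(\rho)}}.$$
   Context: Setting. Let $m\ge 1$, $[m]=\{1,\dots,m\}$, and let $I_1,\dots,I_m\ge 2$ be integers. Put $\mathcal{I}_j=\{1,\dots,I_j\}$ and $\mathcal{I}=\mathcal{I}_1\times\cdots\times\mathcal{I}_m$. For $D\subset[m]$ let $D^C=[m]\setminus D$, $\mathcal{I}_D=\prod_{j\in D}\mathcal{I}_j$ (a one-element set if $D=\emptyset$), and for $\mathbf{i}\in\mathcal{I}$ let $\mathbf{i}_D=(i_j)_{j\in D}$. $S_X$ denotes the symmetric group on a set $X$. $\mathrm{facet}(\Delta)$ is the set of maximal simplices of $\Delta$; not every $j\in[m]$ need be a vertex of $\Delta$. For $D\subset[m]$, $S_{\mathcal{I}_{D^C}}\,\mathrm{wr}\,S_{\mathcal{I}_D}$ is the set $S_{\mathcal{I}_D}\times(S_{\mathcal{I}_{D^C}})^{\mathcal{I}_D}$,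 where $(S_{\mathcal{I}_{D^C}})^{\mathcal{I}_D}$ is the set of all functions $\mathcal{I}_D\to S_{\mathcal{I}_{D^C}}$, regarded as a subgroup of $S_{\mathcal{I}}$ via the action in which $g=(h,\tilde h)$ sends $\mathbf{i}$ to the cell $g\mathbf{i}$ with $(g\mathbf{i})_D=h\,\mathbf{i}_D$ and $(g\mathbf{i})_{D^C}=\tilde h(\mathbf{i}_D)\,\mathbf{i}_{D^C}$. Pseudofactor poset. For $i\in[m]$ let $\mathrm{fst}_\Delta(i)=\{D\in\mathrm{facet}(\Delta)\mid i\in D\}$ (possibly empty). Write $i\sim j$ if $\mathrm{fst}_\Delta(i)=\mathrm{fst}_\Delta(j)$. The equivalence classes of $\sim$ are called pseudofactors and $\mathcal{P}=[m]/\!\sim$ is the set of pseudofactors. For $\rho\in\mathcal{P}$ put $\mathrm{fst}_\Delta(\rho)=\mathrm{fst}_\Delta(i)$ for any $i\in\rho$. The partial order on $\mathcal{P}$ is: $\rho\ge\rho'$ if and only if $\mathrm{fst}_\Delta(\rho)\supset\mathrm{fst}_\Delta(\rho')$. The ancestor set of $\rho$ is $A(\rho)=\bigcup_{\rho'>\rho}\rho'\subset[m]$. Wreath product indexed by $\mathcal{P}$. It is the set $W=\prod_{\rho\in\mathcal{P}}(S_{\mathcal{I}_\rho})^{\mathcal{I}_{A(\rho)}}$, where $(S_{\mathcal{I}_\rho})^{\mathcal{I}_{A(\rho)}}$ is the set of all functions from $\mathcal{I}_{A(\rho)}$ to $S_{\mathcal{I}_\rho}$ ($\mathcal{I}_{A(\rho)}$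 is a one-element set if $A(\rho)=\emptyset$), regarded as a subgroup of $S_{\mathcal{I}}$ via the action in which $w=(w_\rho)_{\rho\in\mathcal{P}}$ sends $\mathbf{i}$ to the cell $w\mathbf{i}$ with $(w\mathbf{i})_\rho=w_\rho(\mathbf{i}_{A(\rho)})\,\mathbf{i}_\rho$ for every $\rho\in\mathcal{P}$. *)

(* Defs.v *)
From HB Require Import structures.
From mathcomp Require Import all_boot all_order all_fingroup.

Set Implicit Arguments.
Unset Strict Implicit.
Unset Printing Implicit Defensive.

Import Order.TTheory.
Local Open Scope group_scope.

(* [m] is 'I_m and the j-th index set is 'I_(I j), i.e. both are 0-based. *)

Definition cell (m : nat) (I : 'I_m -> nat) : Type :=
  {dffun forall j : 'I_m, 'I_(I j)}.

HB.instance Definition _ (m : nat) (I : 'I_m -> nat) := Finite.on (cell I).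

Definition marg (m : nat) (I : 'I_m -> nat) (D : {set 'I_m}) : Type :=
  {dffun forall j : {j : 'I_m | j \in D}, 'I_(I (val j))}.

HB.instance Definition _ (m : nat) (I : 'I_m -> nat) (D : {set 'I_m}) :=
  Finite.on (marg I D).

Definition restr (m : nat) (I : 'I_m -> nat) (D : {set 'I_m}) (i : cell I) :
    marg I D :=
  [ffun j : {j : 'I_m | j \in D} => i (val j)].

Lemma restr_eqP (m : nat) (I : 'I_m -> nat) (D : {set 'I_m}) (i i' : cell I) :
  restr D i = restr D i' <-> (forall j, j \in D -> i j = i' j).
Proof.
split=> [/ffunP eqD j jD | eqD].
  by have := eqD (Sub j jD); rewrite !ffunE /=.
by apply/ffunP=> j; rewrite !ffunE; apply: eqD; apply: valP.
Qed.

(* The cell with D-marginal x and D^C-marginal y. *)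
Definition glue (m : nat) (I : 'I_m -> nat) (D : {set 'I_m})
    (x : marg I D) (y : marg I (~: D)) : cell I :=
  [ffun j : 'I_m =>
     match boolP (j \in D) with
     | AltTrue jD => x (Sub j jD)
     | AltFalse jND => y (Sub j (introT setCP (negP jND)))
     end].

Lemma glueK1 (m : nat) (I : 'I_m -> nat) (D : {set 'I_m})
    (x : marg I D) (y : marg I (~: D)) : restr D (glue x y) = x.
Proof.
apply/ffunP=> -[j jD]; rewrite !ffunE /=.
case: {-}_ / boolP => [jD' | /negP//].
by rewrite (bool_irrelevance jD' jD).
Qed.

Lemma glueK2 (m : nat) (I : 'I_m -> nat) (D : {set 'I_m})
    (x : marg I D) (y : marg I (~: D)) : restr (~: D) (glue x y) = y.
Proof.
apply/ffunP=> -[j jD]; rewrite !ffunE /=.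
case: {-}_ / boolP => [jD' | jND]; first by case/setCP: (jD).
by rewrite (bool_irrelevance (introT setCP (negP jND)) jD).
Qed.

Lemma restr_inj (m : nat) (I : 'I_m -> nat) (D : {set 'I_m}) (i i' : cell I) :
  restr D i = restr D i' -> restr (~: D) i = restr (~: D) i' -> i = i'.
Proof.
move=> /restr_eqP e1 /restr_eqP e2; apply/ffunP=> j.
by case: (boolP (j \in D)) => jD; [apply: e1 | apply: e2; rewrite inE].
Qed.

Definition wreath_dom (m : nat) (I : 'I_m -> nat) (D : {set 'I_m}) : Type :=
  ({perm marg I D} * {ffun marg I D -> {perm marg I (~: D)}})%type.

HB.instance Definition _ (m : nat) (I : 'I_m -> nat) (D : {set 'I_m}) :=
  Finite.on (wreath_dom I D).

Definition wreath_act (m : nat) (I : 'I_m -> nat) (D : {set 'I_m})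
    (g : wreath_dom I D) (i : cell I) : cell I :=
  glue (g.1 (restr D i)) (g.2 (restr D i) (restr (~: D) i)).

Lemma wreath_act_inj (m : nat) (I : 'I_m -> nat) (D : {set 'I_m})
    (g : wreath_dom I D) : injective (wreath_act g).
Proof.
move=> i i' eq_g.
have e1 : restr D i = restr D i'.
  by have := congr1 (restr D) eq_g; rewrite !glueK1 => /perm_inj.
apply: (restr_inj e1).
by have := congr1 (restr (~: D)) eq_g; rewrite !glueK2 e1 => /perm_inj.
Qed.

Definition wreath_perm (m : nat) (I : 'I_m -> nat) (D : {set 'I_m})
    (g : wreath_dom I D) : {perm cell I} := perm (@wreath_act_inj m I D g).

(* S_{I_{D^C}} wr S_{I_D} inside the symmetric group on the cells. *)
Definition wreath (m : nat) (I : 'I_m -> nat) (D : {set 'I_m}) :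
    {set {perm cell I}} :=
  [set wreath_perm g | g : wreath_dom I D].

Lemma wreathP (m : nat) (I : 'I_m -> nat) (D : {set 'I_m})
    (p : {perm cell I}) :
  reflect
    (exists g : wreath_dom I D, forall i : cell I,
       restr D (p i) = g.1 (restr D i) /\
       restr (~: D) (p i) = g.2 (restr D i) (restr (~: D) i))
    (p \in wreath I D).
Proof.
apply: (iffP imsetP) => [[g _ ->] | [g gP]]; exists g => //.
  by move=> i; rewrite permE glueK1 glueK2.
apply/permP=> i; rewrite permE; have [e1 e2] := gP i.
by apply: (@restr_inj _ _ D); rewrite ?glueK1 ?glueK2.
Qed.

Lemma group_set_wreath (m : nat) (I : 'I_m -> nat) (D : {set 'I_m}) :
  group_set (wreath I D).
Proof.
apply/group_setP; split=> [|p q /wreathP[g gP] /wreathP[h hP]].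
  by apply/wreathP; exists (1, [ffun=> 1]) => i; rewrite ffunE !perm1.
apply/wreathP; exists (g.1 * h.1, [ffun x => g.2 x * h.2 (g.1 x)]) => i.
have [g1 g2] := gP i; have [h1 h2] := hP (p i).
by rewrite ffunE !permM h1 h2 g1 g2.
Qed.

Canonical wreath_group (m : nat) (I : 'I_m -> nat) (D : {set 'I_m}) :=
  Group (group_set_wreath I D).

(* The void complex (no face at all) is allowed, and singletons need not be
   faces. *)
Definition simplicial_complex (m : nat) (Delta : {set {set 'I_m}}) : Prop :=
  forall E F : {set 'I_m}, F \in Delta -> E \subset F -> E \in Delta.

Definition facet (m : nat) (Delta : {set {set 'I_m}}) : {set {set 'I_m}} :=
  [set D | maxset (fun E : {set 'I_m} => E \in Delta) D].

Definition fst_facet (m : nat) (Delta : {set {set 'I_m}}) (i : 'I_m) :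
    {set {set 'I_m}} :=
  [set D in facet Delta | i \in D].

Definition pseudofactors (m : nat) (Delta : {set {set 'I_m}}) :
    {set {set 'I_m}} :=
  equivalence_partition
    (fun i j : 'I_m => fst_facet Delta i == fst_facet Delta j) [set: 'I_m].

Record pseudofactor (m : nat) (Delta : {set {set 'I_m}}) := Pseudofactor {
  pf_set : {set 'I_m};
  pf_setP : pf_set \in pseudofactors Delta
}.

HB.instance Definition _ (m : nat) (Delta : {set {set 'I_m}}) :=
  [isSub for @pf_set m Delta].
HB.instance Definition _ (m : nat) (Delta : {set {set 'I_m}}) :=
  [Finite of pseudofactor Delta by <:].

Lemma pseudofactors_partition (m : nat) (Delta : {set {set 'I_m}}) :
  partition (pseudofactors Delta) [set: 'I_m].
Proof. exact: preim_partitionP. Qed.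

Lemma pf_of_subproof (m : nat) (Delta : {set {set 'I_m}}) (j : 'I_m) :
  pblock (pseudofactors Delta) j \in pseudofactors Delta.
Proof.
by apply: pblock_mem; rewrite (cover_partition (pseudofactors_partition _)).
Qed.

Definition pf_of (m : nat) (Delta : {set {set 'I_m}}) (j : 'I_m) :
    pseudofactor Delta := Pseudofactor (pf_of_subproof Delta j).

Lemma mem_pf_of (m : nat) (Delta : {set {set 'I_m}}) (j : 'I_m) :
  j \in pf_set (pf_of Delta j).
Proof. by rewrite mem_pblock (cover_partition (pseudofactors_partition _)). Qed.

Lemma pf_of_eq (m : nat) (Delta : {set {set 'I_m}}) (rho : pseudofactor Delta)
    (j : 'I_m) : j \in pf_set rho -> pf_of Delta j = rho.
Proof.
move=> jr; apply: val_inj; apply: (def_pblock _ (pf_setP rho) jr).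
by case/and3P: (pseudofactors_partition Delta).
Qed.

Lemma eq_pf_of (m : nat) (Delta : {set {set 'I_m}}) (i j : 'I_m) :
  (pf_of Delta i == pf_of Delta j) = (fst_facet Delta i == fst_facet Delta j).
Proof.
rewrite -val_eqE /=.
have eqiR : {in [set: 'I_m] & &, equivalence_rel
    (fun i j : 'I_m => fst_facet Delta i == fst_facet Delta j)}.
  by split=> // /eqP->.
rewrite eq_pblock ?(cover_partition (pseudofactors_partition _)) ?inE //.
  by rewrite pblock_equivalence_partition ?inE.
by case/and3P: (pseudofactors_partition Delta).
Qed.

Lemma pf_neq0 (m : nat) (Delta : {set {set 'I_m}})
    (rho : pseudofactor Delta) : exists i : 'I_m, i \in pf_set rho.
Proof.
apply/set0Pn; apply: contraTneq (pf_setP rho) => ->.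
by case/and3P: (pseudofactors_partition Delta).
Qed.

(* fst_facet at an arbitrary element of rho; see fst_pfE for independence of
   the choice. *)
Definition fst_pf (m : nat) (Delta : {set {set 'I_m}})
    (rho : pseudofactor Delta) : {set {set 'I_m}} :=
  fst_facet Delta (xchoose (pf_neq0 rho)).

Lemma fst_pfE (m : nat) (Delta : {set {set 'I_m}}) (rho : pseudofactor Delta)
    (i : 'I_m) : i \in pf_set rho -> fst_pf rho = fst_facet Delta i.
Proof.
move=> ir; apply/eqP; rewrite -eq_pf_of (pf_of_eq ir).
by rewrite (pf_of_eq (xchooseP (pf_neq0 rho))).
Qed.

Definition pf_le (m : nat) (Delta : {set {set 'I_m}})
    (rho rho' : pseudofactor Delta) : bool :=
  fst_pf rho \subset fst_pf rho'.

Lemma pf_le_refl (m : nat) (Delta : {set {set 'I_m}}) :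
  reflexive (@pf_le m Delta).
Proof. by move=> rho; apply: subxx. Qed.

Lemma pf_le_anti (m : nat) (Delta : {set {set 'I_m}}) :
  antisymmetric (@pf_le m Delta).
Proof.
move=> rho rho'; rewrite /pf_le -eqEsubset.
have [i ir] := pf_neq0 rho; have [j jr] := pf_neq0 rho'.
by rewrite (fst_pfE ir) (fst_pfE jr) -eq_pf_of (pf_of_eq ir) (pf_of_eq jr)
  => /eqP.
Qed.

Lemma pf_le_trans (m : nat) (Delta : {set {set 'I_m}}) :
  transitive (@pf_le m Delta).
Proof. by move=> ? ? ?; apply: subset_trans. Qed.

HB.instance Definition _ (m : nat) (Delta : {set {set 'I_m}}) :=
  Order.Le_isPOrder.Build (Order.Disp tt tt) (pseudofactor Delta)
    (@pf_le_refl m Delta) (@pf_le_anti m Delta) (@pf_le_trans m Delta).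

Definition ancestors (m : nat) (Delta : {set {set 'I_m}})
    (rho : pseudofactor Delta) : {set 'I_m} :=
  \bigcup_(rho' : pseudofactor Delta | (rho < rho')%O) pf_set rho'.

Definition poset_wreath_dom (m : nat) (I : 'I_m -> nat)
    (Delta : {set {set 'I_m}}) : Type :=
  {dffun forall rho : pseudofactor Delta,
     {ffun marg I (ancestors rho) -> {perm marg I (pf_set rho)}}}.

HB.instance Definition _ (m : nat) (I : 'I_m -> nat)
  (Delta : {set {set 'I_m}}) := Finite.on (poset_wreath_dom I Delta).

(* Coordinate j is read off from the block rho containing j. *)
Definition poset_wreath_act (m : nat) (I : 'I_m -> nat)
    (Delta : {set {set 'I_m}}) (w : poset_wreath_dom I Delta) (i : cell I) :
    cell I :=
  [ffun j : 'I_m =>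
     (let rho := pf_of Delta j in
      w rho (restr (ancestors rho) i) (restr (pf_set rho) i)
        (exist _ j (mem_pf_of Delta j))) : 'I_(I j)].

Lemma poset_wreath_actE (m : nat) (I : 'I_m -> nat)
    (Delta : {set {set 'I_m}}) (w : poset_wreath_dom I Delta) (i : cell I)
    (rho : pseudofactor Delta) :
  restr (pf_set rho) (poset_wreath_act w i)
    = w rho (restr (ancestors rho) i) (restr (pf_set rho) i).
Proof.
apply/ffunP=> -[j jr]; rewrite ffunE -[val _]/j ffunE; cbv zeta.
move: (mem_pf_of Delta j); rewrite (pf_of_eq jr) => jr'.
by rewrite (bool_irrelevance jr' jr).
Qed.

Lemma restr_pf_inj (m : nat) (I : 'I_m -> nat) (Delta : {set {set 'I_m}})
    (i i' : cell I) :
  (forall rho : pseudofactor Delta, restr (pf_set rho) i = restr (pf_set rho) i') ->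
  i = i'.
Proof.
move=> eqr; apply/ffunP=> j.
by have /restr_eqP := eqr (pf_of Delta j); apply; apply: mem_pf_of.
Qed.

Lemma poset_wreath_act_inj (m : nat) (I : 'I_m -> nat)
    (Delta : {set {set 'I_m}}) (w : poset_wreath_dom I Delta) :
  injective (poset_wreath_act w).
Proof.
move=> i i' eq_w; apply: (@restr_pf_inj _ _ Delta).
suff IH n (rho : pseudofactor Delta) :
    #|[set s | (rho < s)%O]| <= n -> restr (pf_set rho) i = restr (pf_set rho) i'.
  by move=> rho; apply: (IH _ rho (leqnn _)).
elim: n rho => [|n IHn] rho le_n.
all: have eqA : restr (ancestors rho) i = restr (ancestors rho) i';
  last by have := congr1 (restr (pf_set rho)) eq_w;
    rewrite !poset_wreath_actE eqA => /perm_inj.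
all: apply/restr_eqP => j /bigcupP[s lt_s js].
  by move: le_n; rewrite leqn0 cards_eq0 => /eqP/setP/(_ s); rewrite !inE lt_s.
have /restr_eqP : restr (pf_set s) i = restr (pf_set s) i'; last exact.
apply: IHn; rewrite -ltnS; apply: leq_trans le_n; apply: proper_card.
apply/properP; split.
  by apply/subsetP=> t; rewrite !inE; apply: lt_trans.
by exists s; rewrite !inE ?ltxx.
Qed.

Definition poset_wreath_perm (m : nat) (I : 'I_m -> nat)
    (Delta : {set {set 'I_m}}) (w : poset_wreath_dom I Delta) :
    {perm cell I} := perm (@poset_wreath_act_inj m I Delta w).

Definition poset_wreath (m : nat) (I : 'I_m -> nat)
    (Delta : {set {set 'I_m}}) : {set {perm cell I}} :=
  [set poset_wreath_perm w | w : poset_wreath_dom I Delta].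

Lemma poset_wreathP (m : nat) (I : 'I_m -> nat) (Delta : {set {set 'I_m}})
    (p : {perm cell I}) :
  reflect
    (exists w : poset_wreath_dom I Delta,
       forall (i : cell I) (rho : pseudofactor Delta),
       restr (pf_set rho) (p i)
         = w rho (restr (ancestors rho) i) (restr (pf_set rho) i))
    (p \in poset_wreath I Delta).
Proof.
apply: (iffP imsetP) => [[w _ ->] | [w wP]]; exists w => //.
  by move=> i rho; rewrite permE poset_wreath_actE.
apply/permP=> i; apply: (@restr_pf_inj _ _ Delta) => rho.
by rewrite permE poset_wreath_actE wP.
Qed.

Lemma group_set_poset_wreath (m : nat) (I : 'I_m -> nat)
    (Delta : {set {set 'I_m}}) : group_set (poset_wreath I Delta).
Proof.
apply/group_setP; split=> [|p q /poset_wreathP[v vP] /poset_wreathP[w wP]].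
  apply/poset_wreathP.
  exists [ffun rho : pseudofactor Delta =>
    [ffun=> 1] : {ffun marg I (ancestors rho) -> {perm marg I (pf_set rho)}}].
  by move=> i rho; rewrite !ffunE !perm1.
have restrAp i i' (rho : pseudofactor Delta) :
    restr (ancestors rho) i = restr (ancestors rho) i' ->
  restr (ancestors rho) (p i) = restr (ancestors rho) (p i').
  move=> /restr_eqP eqA; apply/restr_eqP => j /bigcupP[s lt_s js].
  suff /restr_eqP : restr (pf_set s) (p i) = restr (pf_set s) (p i') by apply.
  rewrite !vP; congr (v s _ _); apply/restr_eqP => k.
    move=> /bigcupP[t lt_t kt]; apply: eqA.
    by apply/bigcupP; exists t => //; apply: lt_trans lt_t.
  by move=> ks; apply: eqA; apply/bigcupP; exists s.
pose pA (rho : pseudofactor Delta) (x : marg I (ancestors rho)) :=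
  if [pick i : cell I | restr (ancestors rho) i == x] is Some i
  then restr (ancestors rho) (p i) else x.
apply/poset_wreathP.
exists [ffun rho : pseudofactor Delta =>
    [ffun x => v rho x * w rho (pA rho x)]
      : {ffun marg I (ancestors rho) -> {perm marg I (pf_set rho)}}].
move=> i rho; rewrite !ffunE !permM wP vP; congr (w rho _ _).
rewrite /pA; case: pickP => [i' /eqP/restrAp-> // | /(_ i)].
by rewrite eqxx.
Qed.

Canonical poset_wreath_group (m : nat) (I : 'I_m -> nat)
    (Delta : {set {set 'I_m}}) := Group (group_set_poset_wreath I Delta).

(* Main.v *)
Require Import Defs.
From mathcomp Require Import all_boot all_order all_fingroup.

(** Call a set [D] of coordinates autonomous for a permutation [p] of the cells
    if the [D]-marginal of [p i] is a function of the [D]-marginal of [i].  Both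
    sides of the theorem are described by autonomous sets.

    A permutation lies in the wreath product for [D] exactly when [D] is
    autonomous for it ([wreath_autonomousP]).  The point is that, by finiteness,
    [D] is then autonomous for the inverse of [p] as well, so that the map
    induced by [p] on [D]-marginals is a bijection, and so is the map between
    fibres over corresponding [D]-marginals.

    Likewise a permutation lies in the wreath product indexed by the poset
    exactly when, for every pseudofactor [rho], the up-set
    [ancestors rho :|: pf_set rho] is autonomous ([poset_wreath_autonomousP]).
    The set [ancestors rho] is the union of the up-sets of the pseudofactors
    above [rho], hence autonomous too, and this is what makes the action on the
    block [rho] bijective once the coordinates in [ancestors rho] are fixed.

    It remains to compare the facets with these up-sets.  The up-set of [rho] is
    the intersection of the facets containing [rho] ([pf_upset_bigcap]), and
    autonomous sets are closed under intersection: two cells that agree on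
    [D :&: E] are linked by a third one that agrees with the first on [D] and
    with the second on [E].  Conversely a facet is the union of the up-sets of
    the pseudofactors it meets ([facet_bigcup]), and autonomous sets are closed
    under union. *)

Set Implicit Arguments.
Unset Strict Implicit.
Unset Printing Implicit Defensive.

Local Open Scope group_scope.

Section Autonomous.

Variables (m : nat) (I : 'I_m -> nat).
Implicit Types (D E : {set 'I_m}) (i : cell I) (p : {perm cell I}).

Definition agree D (i i' : cell I) : Prop := forall j, j \in D -> i j = i' j.

Definition autonomous (f : cell I -> cell I) D : Prop :=
  forall i i', agree D i i' -> agree D (f i) (f i').

Lemma agree_sym D i i' : agree D i i' -> agree D i' i.
Proof. by move=> eqD j /eqD. Qed.

Lemma agree_trans D i i' i'' :
  agree D i i' -> agree D i' i'' -> agree D i i''.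
Proof. by move=> e1 e2 j jD; rewrite e1 // e2. Qed.

Lemma agreeS D E i i' : D \subset E -> agree E i i' -> agree D i i'.
Proof. by move=> /subsetP sDE eqE j /sDE /eqE. Qed.

Lemma glue_in D (x : marg I D) y i :
  x = restr D i -> agree D (glue x y) i.
Proof. by move=> ->; apply/restr_eqP; rewrite glueK1. Qed.

Lemma glue_out D (x : marg I D) y i :
  y = restr (~: D) i -> agree (~: D) (glue x y) i.
Proof. by move=> ->; apply/restr_eqP; rewrite glueK2. Qed.

(** The linking cell takes the coordinates in [D] from [i] and all others from
    [i']; it agrees with [i'] on [E] because [i] and [i'] agree on [D :&: E]. *)
Lemma autonomousI f D E :
  autonomous f D -> autonomous f E -> autonomous f (D :&: E).
Proof.
move=> fD fE i i' eqDE.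
pose k := glue (restr D i) (restr (~: D) i').
have kD : agree D k i by apply: glue_in.
have kE : agree E k i'.
  move=> j jE; case: (boolP (j \in D)) => jD.
    by rewrite kD // eqDE // inE jD.
  by apply: (glue_out (restr D i) (erefl (restr (~: D) i'))); rewrite inE.
apply: (@agree_trans _ _ (f k)).
  exact: (agreeS (subsetIl _ _) (agree_sym (fD _ _ kD))).
exact: (agreeS (subsetIr _ _) (fE _ _ kE)).
Qed.

Lemma autonomous_bigcap f (Ds : {set {set 'I_m}}) :
  (forall D, D \in Ds -> autonomous f D) -> autonomous f (\bigcap_(D in Ds) D).
Proof.
move=> fDs; apply: (big_ind (autonomous f)) => //; last exact: autonomousI.
move=> i i' eqT; have -> // : i = i'.
by apply/ffunP => j; apply: eqT; rewrite inE.
Qed.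

Lemma autonomous_bigcup f (T : finType) (P : pred T) (F : T -> {set 'I_m}) :
  (forall t, P t -> autonomous f (F t)) ->
  autonomous f (\bigcup_(t | P t) F t).
Proof.
move=> fF i i' eqU j /bigcupP[t Pt jt].
by apply: (fF t Pt i i' _ j jt); apply: agreeS eqU; apply: bigcup_sup.
Qed.

(** The cells being finitely many, the inverse of [p] is a power of [p]. *)
Lemma autonomousV p D : autonomous p D -> autonomous p^-1 D.
Proof.
move=> pD; rewrite invg_expg.
elim: _.-1 => [|n IHn] i i' eqD; first by rewrite !perm1.
by rewrite expgS !permM; apply/IHn/pD.
Qed.

(** Reflecting agreement is what turns the maps induced on marginals into
    permutations. *)
Lemma autonomous_agreeE p D i i' :
  autonomous p D -> agree D (p i) (p i') <-> agree D i i'.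
Proof.
move=> pD; split=> [eqp|]; last exact: pD.
by have := autonomousV pD eqp; rewrite !permK.
Qed.

End Autonomous.

Section Wreath.

Variables (m : nat) (I : 'I_m -> nat).
(* Marginals are extended to cells by means of this default cell. *)
Variable i0 : cell I.
Implicit Types (D : {set 'I_m}) (p : {perm cell I}).

(** The top permutation is injective because agreement on [D] can be pulled back
    along [p]; the bottom permutations are injective because [p] is, once the
    image marginal on [D] is known to be constant on the fibre. *)
Lemma wreath_autonomousP p D : p \in wreath I D <-> autonomous p D.
Proof.
split=> [/wreathP[g gP] i i' /restr_eqP eqD | pD].
  by apply/restr_eqP; rewrite (gP i).1 (gP i').1 eqD.
pose top x := restr D (p (glue x (restr (~: D) i0))).
have top_inj : injective top.
  move=> x x' /restr_eqP /(autonomous_agreeE _ _ pD) /restr_eqP.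
  by rewrite !glueK1.
pose bot (x : marg I D) y := restr (~: D) (p (glue x y)).
have bot_inj x : injective (bot x).
  move=> y y' eq_bot; rewrite -(glueK2 x y) -(glueK2 x y').
  congr restr; apply: (@perm_inj _ p); apply: restr_inj eq_bot.
  by apply/restr_eqP/pD/restr_eqP; rewrite !glueK1.
apply/wreathP; exists (perm top_inj, [ffun x => perm (bot_inj x)]) => i /=.
rewrite ffunE !permE; split.
  by apply/restr_eqP/pD/restr_eqP; rewrite glueK1.
by rewrite /bot; congr (restr _ (p _)); apply: (@restr_inj _ _ D);
  rewrite ?glueK1 ?glueK2.
Qed.

Variable Delta : {set {set 'I_m}}.
Implicit Types rho : pseudofactor Delta.

Definition pf_upset rho : {set 'I_m} := ancestors rho :|: pf_set rho.

Lemma mem_ancestors rho j :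
  (j \in ancestors rho) = (rho < pf_of Delta j)%O.
Proof.
apply/bigcupP/idP => [[s lt_s /pf_of_eq->] // | lt_j].
by exists (pf_of Delta j) => //; apply: mem_pf_of.
Qed.

Lemma mem_pf_set rho j : (j \in pf_set rho) = (rho == pf_of Delta j).
Proof.
by apply/idP/eqP => [/pf_of_eq-> // | ->]; apply: mem_pf_of.
Qed.

Lemma mem_pf_upset rho j :
  (j \in pf_upset rho) = (fst_pf rho \subset fst_facet Delta j).
Proof.
rewrite inE mem_ancestors mem_pf_set orbC -Order.POrderTheory.le_eqVlt.
by rewrite -(fst_pfE (mem_pf_of Delta j)).
Qed.

Lemma disjoint_ancestors rho : [disjoint ancestors rho & pf_set rho].
Proof.
rewrite disjoint_subset; apply/subsetP => j.
rewrite mem_ancestors inE mem_pf_set Order.POrderTheory.lt_neqAle.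
by case/andP.
Qed.

Lemma ancestorsE rho :
  ancestors rho = \bigcup_(s | (rho < s)%O) pf_upset s.
Proof.
apply/setP => j; apply/idP/bigcupP => [/bigcupP[s lt_s js] | [s lt_s]].
  by exists s => //; rewrite inE js orbT.
rewrite inE !mem_ancestors mem_pf_set => /orP[|/eqP<- //].
exact: Order.POrderTheory.lt_trans.
Qed.

(** A coordinate [j] lies above [rho] when every facet containing [rho] contains
    [j].  If no facet contains [rho], both sides are the whole coordinate
    set. *)
Lemma pf_upset_bigcap rho : pf_upset rho = \bigcap_(D in fst_pf rho) D.
Proof.
have [k kr] := pf_neq0 rho.
apply/setP => j; rewrite mem_pf_upset (fst_pfE kr).
apply/subsetP/bigcapP => sub D Dk.
  by have := sub D Dk; rewrite inE => /andP[].
have := sub D Dk; move: Dk; rewrite !inE => /andP[-> _] //.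
Qed.

Lemma facet_bigcup D :
  D \in facet Delta -> D = \bigcup_(rho | D \in fst_pf rho) pf_upset rho.
Proof.
move=> facetD; apply/setP => j; apply/idP/bigcupP => [jD | [rho Drho]].
  have Dj : D \in fst_pf (pf_of Delta j).
    by rewrite (fst_pfE (mem_pf_of Delta j)) inE facetD.
  by exists (pf_of Delta j) => //; rewrite inE mem_pf_of orbT.
by rewrite pf_upset_bigcap => /bigcapP; apply.
Qed.

(** Backwards, the permutation of the block [rho] over a marginal [x] on
    [ancestors rho] is read off from cells extending [x].  It is injective for
    two reasons: [ancestors rho] is autonomous, so that images of such cells
    that agree on the block agree on the whole up-set, and agreement on the
    up-set can be pulled back along [p]. *)
Lemma poset_wreath_autonomousP p :
  p \in poset_wreath I Delta <-> forall rho, autonomous p (pf_upset rho).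
Proof.
split=> [/poset_wreathP[w wP] rho i i' eqU | pU].
  (* The coordinates in the block of j depend only on the up-set of that block,
     which is contained in the up-set of rho. *)
  move=> j; rewrite mem_pf_upset => le_j.
  suff /restr_eqP : restr (pf_set (pf_of Delta j)) (p i)
                  = restr (pf_set (pf_of Delta j)) (p i').
    by apply; apply: mem_pf_of.
  have eqUj : agree (pf_upset (pf_of Delta j)) i i'.
    apply: agreeS eqU; apply/subsetP => k; rewrite !mem_pf_upset.
    by rewrite (fst_pfE (mem_pf_of Delta j)); apply: subset_trans.
  rewrite !wP; congr (w _ _ _); apply/restr_eqP; apply: agreeS eqUj.
    exact: subsetUl.
  exact: subsetUr.
have pA rho : autonomous p (ancestors rho).
  by rewrite ancestorsE; apply: autonomous_bigcup.
pose fill rho x z : cell I :=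
  glue x (restr (~: ancestors rho)
            (glue z (restr (~: pf_set rho) i0))).
have fillA rho x z : restr (ancestors rho) (fill rho x z) = x.
  exact: glueK1.
have fillB rho x z : restr (pf_set rho) (fill rho x z) = z.
  apply: etrans (glueK1 z (restr (~: pf_set rho) i0)); apply/restr_eqP => j jB.
  apply: (glue_out x (erefl _)); rewrite inE.
  by apply: contraTN jB => /(disjointFr (disjoint_ancestors rho))->.
pose act rho x z := restr (pf_set rho) (p (fill rho x z)).
have act_inj rho x : injective (act rho x).
  move=> z z' /restr_eqP eqB; rewrite -(fillB rho x z) -(fillB rho x z').
  have eqU : agree (pf_upset rho) (p (fill rho x z)) (p (fill rho x z')).
    move=> j /setUP[]; last exact: eqB.
    by move: j; apply/pA/restr_eqP; rewrite !fillA.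
  apply/restr_eqP; apply: agreeS (subsetUr (ancestors rho) _) _.
  exact/(autonomous_agreeE _ _ (pU rho)).
apply/poset_wreathP.
exists [ffun rho : pseudofactor Delta =>
  [ffun x => perm (act_inj rho x)]
    : {ffun marg I (ancestors rho) -> {perm marg I (pf_set rho)}}].
move=> i rho; rewrite !ffunE permE /act; apply/restr_eqP.
apply: agreeS (subsetUr (ancestors rho) _) _; apply: (pU rho).
by move=> j /setUP[]; move: j; apply/restr_eqP; rewrite ?fillA ?fillB.
Qed.

End Wreath.

Theorem theorem2 (m : nat) (I : 'I_m -> nat) (Delta : {set {set 'I_m}})
  (m_ge1 : (1 <= m)%N) (I_ge2 : forall j : 'I_m, (2 <= I j)%N)
  (Delta_complex : simplicial_complex Delta) :
  \bigcap_(D in facet Delta) wreath I D = poset_wreath I Delta.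
Proof.
pose i0 : cell I := [ffun j => Ordinal (ltnW (I_ge2 j))].
apply/setP => p; apply/bigcapP/idP => [pW | /(poset_wreath_autonomousP i0) pU].
  apply/(poset_wreath_autonomousP i0) => rho.
  rewrite pf_upset_bigcap; apply: autonomous_bigcap => D.
  rewrite /fst_pf inE => /andP[/pW pD _].
  exact/(wreath_autonomousP i0).
move=> D facetD; apply/(wreath_autonomousP i0).
by rewrite (facet_bigcup facetD); apply: autonomous_bigcup.
Qed.
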